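(* Let $U\subseteq C^{r_{\mathcal F}}(\Omega,\mathbb{R}^c)\cap C^{r_{\mathcal B}}(\overline\Omega,\mathbb{R}^c)$. Consider finite collocation sets $\Omega^h=\{z_{\mathcal F}^i\}_{i=1}^{N_{\mathcal F}}\subset\Omega$ and $\Gamma^h=\{z_{\mathcal B}^j\}_{j=1}^{N_{\mathcal B}}\subset\Gamma$ with $N_{\mathcal F},N_{\mathcal B}\in\mathbb{N}$, and set $\ell:=N_{\mathcal F}(d+r_{\mathcal F})+N_{\mathcal B}(d+r_{\mathcal B})$. Let $\mathcal H^M$ denote the class of (restrictions to $\overline\Omega$ of) depth-$2$ neural networks $\mathbb{R}^d\to\mathbb{R}^c$ with $c\binom{\ell}{d}$ hidden units (i.e. $M=c\binom{\ell}{d}(d+1)+c\left(c\binom{\ell}{d}+1\right)$ parameters) and activation $\sigma\in C^{\ell-d}(\mathbb{R},\mathbb{R})$ satisfying $\sigma^{(k)}(a)\neq 0$ for some $a\in\mathbb{R}$ and all $0\le k\le \ell-d$; assume $\mathcal H^M\subseteq U$. Then: (i) If $\hat u\in\arg\min_{u\in U}\mathcal J^h(u)$, then there is $u_\theta\in\mathcal H^M$ that minimizes $\mathcal J^h$ over $\mathcal H^M$, with $\mathcal J^h(u_\theta)=\mathcal J^h(\hat u)$ and $u_\theta(z)=\hat u(z)$ for all $z\in\Omega^h\cup\Gamma^h$. (ii) If $\hat u_\theta\in\arg\min_{u_\theta\in\mathcal H^M}\mathcal J^h(u_\theta)$, then $\hat u_\theta\in\arg\min_{u\in U}\mathcal 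J^h(u)$.
   Context: Setting. $d,c,c_{\mathcal F},c_{\mathcal B}\in\mathbb{N}$, $r_{\mathcal F},r_{\mathcal B}\in\mathbb{N}_0$, $\nu\in[1,\infty)$. $\Omega\subset\mathbb{R}^d$ is a bounded domain (open, connected) with Lipschitz boundary, $\Gamma\subseteq\partial\Omega$. $U$ is a Banach space of functions $\overline\Omega\to\mathbb{R}^c$, and $V$, $W$ are Banach spaces of functions $\Omega\to\mathbb{R}^{c_{\mathcal F}}$ and $\Gamma\to\mathbb{R}^{c_{\mathcal B}}$; $U,V,W$ are continuously embedded in $L^\nu(\Omega,\mathbb{R}^c)$, $L^\nu(\Omega,\mathbb{R}^{c_{\mathcal F}})$, $L^\nu(\Gamma,\mathbb{R}^{c_{\mathcal B}})$. The operators $\mathcal F:U\to V$ and $\mathcal B:U\to W$ are (possibly nonlinear) local differential operators of orders $r_{\mathcal F}$, $r_{\mathcal B}$: there are functions $F,B$ with $\mathcal F(u)(z)=F(z,\{D^\beta u(z):|\beta|\le r_{\mathcal F}\})$ for $z\in\Omega$ and $\mathcal B(u)(z)=B(z,\{D^\beta u(z):|\beta|\le r_{\mathcal B}\})$ for $z\in\Gamma$ (derivatives at boundary points are boundary values of the derivatives). AD-PINN functional. Let $\mathcal D^h\subseteq\Omega^h\cup\Gamma^h$ be the set of data locations, with given data $u^*(z)\in\mathbb{R}^c$, $z\in\mathcal D^h$; let $\alpha_{\mathcal F},\alpha_{\mathcal B},\alpha_{\mathcal D}\ge0$ and let $\omega_{\mathcal F}^z,\omega_{\mathcal B}^z,\omega_{\mathcal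 D}^z\in\mathbb{R}$ be quadrature weights (typically $1/|\Omega^h|$, $1/|\Gamma^h|$, $1/|\mathcal D^h|$). For $u\in U$, $$\mathcal J^h(u)=\alpha_{\mathcal F}\sum_{z\in\Omega^h}\omega_{\mathcal F}^z|\mathcal F(u)(z)|_\nu^\nu+\alpha_{\mathcal B}\sum_{z\in\Gamma^h}\omega_{\mathcal B}^z|\mathcal B(u)(z)|_\nu^\nu+\alpha_{\mathcal D}\sum_{z\in\mathcal D^h}\omega_{\mathcal D}^z|u(z)-u^*(z)|_\nu^\nu,$$ where $|\cdot|_\nu$ is the $\ell^\nu$-norm. ''Minimizer'' always means global minimizer. Neural networks. A depth-$2$ (one-hidden-layer) neural network with $m$ hidden units and activation $\sigma$ is a map $f(x)=W_2\,\sigma(W_1x+b_1)+b_2$ with $W_1\in\mathbb{R}^{m\times d}$, $b_1\in\mathbb{R}^m$, $W_2\in\mathbb{R}^{c\times m}$, $b_2\in\mathbb{R}^c$, $\sigma$ applied componentwise; all parameter values are allowed. *)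

(* Defs.v *)
From HB Require Import structures.
From mathcomp Require Import all_boot all_order all_algebra finmap.
From mathcomp Require Import all_classical all_reals all_analysis.

Set Implicit Arguments.
Unset Strict Implicit.
Unset Printing Implicit Defensive.

Import Order.TTheory GRing.Theory Num.Theory.
Import numFieldNormedType.Exports.

Local Open Scope classical_set_scope.
Local Open Scope ring_scope.

(* The outer measure generated by a weight on arbitrary sets.  It is [mu_ext]
   for the semiring of all subsets; [all_sets T] is a copy of [T] carrying it. *)
Section cover_outer.
Local Open Scope ereal_scope.

Definition cover_outer (R : realType) (T : Type) (w : set T -> \bar R)
    (X : set T) : \bar R :=
  ereal_inf [set \sum_(k <oo) w (A k) |
             A in [set A : (set T)^nat | X `<=` \bigcup_k A k]].

Definition all_sets (T : Type) : Type := T.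

Lemma all_sets_measurableC (T : pointedType) (A : set (all_sets T)) :
  [set: set (all_sets T)] A -> [set: set (all_sets T)] (~` A).
Proof. by []. Qed.

Lemma all_sets_measurable_bigcup (T : pointedType) (F : (set (all_sets T))^nat) :
  (forall i, [set: set (all_sets T)] (F i)) ->
  [set: set (all_sets T)] (\bigcup_i F i).
Proof. by []. Qed.

HB.instance Definition _ (T : pointedType) := Pointed.on (all_sets T).
HB.instance Definition _ (T : pointedType) :=
  @isMeasurable.Build default_measure_display (all_sets T) setT I
    (@all_sets_measurableC T) (@all_sets_measurable_bigcup T).

Lemma cover_outerE (R : realType) (T : pointedType) (w : set T -> \bar R) :
  cover_outer w = mu_ext (w : set (all_sets T) -> \bar R).
Proof.
apply/funext => X; rewrite /cover_outer /mu_ext; congr ereal_inf.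
by apply/seteqP; split=> x [A /=]; [|case=> _] => XA <-; exists A.
Qed.

Lemma cover_outer_isOuter (R : realType) (T : pointedType)
    (w : set T -> \bar R) : w set0 = 0 -> (forall A, 0 <= w A) ->
  [/\ cover_outer w set0 = 0, (forall A, 0 <= cover_outer w A),
      {homo cover_outer w : A B / A `<=` B >-> A <= B} &
      sigma_subadditive (cover_outer w)].
Proof.
move=> w0 wge0; rewrite cover_outerE; split.
- exact: mu_ext0.
- by move=> A; exact: mu_ext_ge0.
- exact: (@le_mu_ext _ (all_sets T) R w).
- exact: (@mu_ext_sigma_subadditive _ (all_sets T) R w wge0).
Qed.

End cover_outer.

Section lebesgue.
Local Open Scope ereal_scope.
Variables (R : realType) (d : nat).
Implicit Types (a b : 'cV[R]_d) (A : set 'cV[R]_d).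

Definition closed_box a b : set 'cV[R]_d :=
  [set x | forall i, (a i 0 <= x i 0 <= b i 0)%R].

Definition box_weight A : \bar R :=
  if A == set0 then 0
  else ereal_inf [set (\prod_i (ab.2 i 0 - ab.1 i 0)%R)%:E |
                  ab in [set ab : 'cV[R]_d * 'cV[R]_d |
                         (forall i, (ab.1 i 0 <= ab.2 i 0)%R) /\
                         A = closed_box ab.1 ab.2]].

Definition lebesgue_outer : set 'cV[R]_d -> \bar R := cover_outer box_weight.

Lemma box_weight0 : box_weight set0 = 0.
Proof. by rewrite /box_weight eqxx. Qed.

Lemma box_weight_ge0 A : 0 <= box_weight A.
Proof.
rewrite /box_weight; case: ifPn => // _.
apply: le_ereal_inf_tmp => _ [[a b] [/= ab _] <-].
by rewrite lee_fin prodr_ge0// => i _; rewrite subr_ge0.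
Qed.

HB.instance Definition _ := isOuterMeasure.Build R 'cV[R]_d lebesgue_outer
  (let: And4 h _ _ _ := cover_outer_isOuter box_weight0 box_weight_ge0 in h)
  (let: And4 _ h _ _ := cover_outer_isOuter box_weight0 box_weight_ge0 in h)
  (let: And4 _ _ h _ := cover_outer_isOuter box_weight0 box_weight_ge0 in h)
  (let: And4 _ _ _ h := cover_outer_isOuter box_weight0 box_weight_ge0 in h).

End lebesgue.

(* The s-dimensional Hausdorff outer measure for the Euclidean distance, without
   the normalizing constant, which changes neither the space L^nu nor its
   topology.  For s = 0 it counts points, because 0 `^ 0 = 1. *)
Section hausdorff.
Local Open Scope ereal_scope.
Variables (R : realType) (d : nat) (s : R).
Implicit Types (x y : 'cV[R]_d) (A : set 'cV[R]_d).

Definition euclid_dist x y : R := Num.sqrt (\sum_i (x i 0 - y i 0) ^+ 2)%R.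

Definition diam A : \bar R :=
  ereal_sup [set (euclid_dist xy.1 xy.2)%:E | xy in A `*` A].

Definition hausdorff_weight (delta : R) A : \bar R :=
  if A == set0 then 0
  else if diam A <= delta%:E then diam A `^ s else +oo.

Definition hausdorff_outer A : \bar R :=
  ereal_sup [set cover_outer (hausdorff_weight delta) A |
             delta in [set delta : R | (0 < delta)%R]].

Lemma hausdorff_weight0 delta : hausdorff_weight delta set0 = 0.
Proof. by rewrite /hausdorff_weight eqxx. Qed.

Lemma hausdorff_weight_ge0 delta A : 0 <= hausdorff_weight delta A.
Proof.
by rewrite /hausdorff_weight; case: ifPn => // _; case: ifPn => // _; exact: poweR_ge0.
Qed.

Let isOuter delta :=
  cover_outer_isOuter (hausdorff_weight0 delta) (hausdorff_weight_ge0 delta).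

Let ub_outer delta A : (0 < delta)%R ->
  cover_outer (hausdorff_weight delta) A <= hausdorff_outer A.
Proof. by move=> d0; apply: ereal_sup_ubound; exists delta. Qed.

Lemma hausdorff_outer_ge0 A : 0 <= hausdorff_outer A.
Proof.
by apply: le_trans (ub_outer A ltr01); case: (isOuter 1%R) => _ + _ _; exact.
Qed.

Lemma hausdorff_outer0 : hausdorff_outer set0 = 0.
Proof.
apply/eqP; rewrite eq_le hausdorff_outer_ge0 andbT.
by apply: ge_ereal_sup => _ [delta _ <-]; case: (isOuter delta) => ->.
Qed.

Lemma le_hausdorff_outer :
  {homo hausdorff_outer : A B / A `<=` B >-> A <= B}.
Proof.
move=> A B AB; apply: ge_ereal_sup => _ [delta d0 <-].
apply: le_trans (ub_outer B d0).
by case: (isOuter delta) => _ _ + _; exact.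
Qed.

Lemma hausdorff_outer_sigma_subadditive : sigma_subadditive hausdorff_outer.
Proof.
move=> F; apply: ge_ereal_sup => _ [delta d0 <-].
have [_ ge0 _ /(_ F) /le_trans] := isOuter delta; apply.
by apply: lee_nneseries => [i _ _|i _]; [exact: ge0|exact: ub_outer].
Qed.

HB.instance Definition _ := isOuterMeasure.Build R 'cV[R]_d hausdorff_outer
  hausdorff_outer0 hausdorff_outer_ge0 le_hausdorff_outer
  hausdorff_outer_sigma_subadditive.

End hausdorff.

(* Integrating against the trace of mu on D is integrating over D.  When D is
   mu-measurable, a set is Caratheodory measurable for the trace iff its
   intersection with D is measurable for mu; the trace makes sense for any D. *)
Section outer_trace.
Local Open Scope ereal_scope.
Variables (R : realType) (T : Type) (mu : {outer_measure set T -> \bar R}).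
Variable D : set T.

Definition outer_trace (A : set T) : \bar R := mu (A `&` D).

Lemma outer_trace0 : outer_trace set0 = 0.
Proof. by rewrite /outer_trace set0I outer_measure0. Qed.

Lemma outer_trace_ge0 A : 0 <= outer_trace A.
Proof. exact: outer_measure_ge0. Qed.

Lemma le_outer_trace : {homo outer_trace : A B / A `<=` B >-> A <= B}.
Proof. by move=> A B AB; apply: le_outer_measure; exact: setSI. Qed.

Lemma outer_trace_sigma_subadditive : sigma_subadditive outer_trace.
Proof.
by move=> F; rewrite /outer_trace setI_bigcupl; exact: outer_measure_sigma_subadditive.
Qed.

HB.instance Definition _ := isOuterMeasure.Build R T outer_trace
  outer_trace0 outer_trace_ge0 le_outer_trace outer_trace_sigma_subadditive.

End outer_trace.

Section spaces.
Variables (R : realType) (d : nat).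
Implicit Types (m : nat) (nu : R) (A : set 'cV[R]_d).

Definition lnorm nu m (y : 'cV[R]_m) : R :=
  (\sum_i `|y i 0| `^ nu) `^ nu^-1.

Definition Lnu_norm (mu : {outer_measure set 'cV[R]_d -> \bar R}) nu m
    (f : 'cV[R]_d -> 'cV[R]_m) : \bar R :=
  Lnorm (mu : set (caratheodory_type mu) -> \bar R) nu%:E
        (fun x => (lnorm nu (f x))%:E).

Definition Lnu_fun (mu : {outer_measure set 'cV[R]_d -> \bar R}) nu m
    (f : 'cV[R]_d -> 'cV[R]_m) : Prop :=
  (forall i, measurable_fun [set: caratheodory_type mu] (fun x => f x i 0)) /\
  (Lnu_norm mu nu f < +oo)%E.

(* X is a vector space of functions A -> R^m: [ev u] is the function u, of which
   only the values on A are meaningful. *)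
Definition function_space A (X : lmodType R) m
    (ev : X -> 'cV[R]_d -> 'cV[R]_m) : Prop :=
  (forall (k : R) u v x, A x -> ev (k *: u + v) x = k *: ev u x + ev v x) /\
  (forall u v, (forall x, A x -> ev u x = ev v x) -> u = v).

(* Continuous embedding into L^nu(mu, R^m), whose elements are classes modulo
   equality almost everywhere: the class map is well defined, injective and
   bounded. *)
Definition embedded_in_Lnu (mu : {outer_measure set 'cV[R]_d -> \bar R}) nu
    (X : normedModType R) m (ev : X -> 'cV[R]_d -> 'cV[R]_m) : Prop :=
  [/\ (forall u, Lnu_fun mu nu (ev u)),
      (forall u v, {ae (mu : set (caratheodory_type mu) -> \bar R),
                      forall x, ev u x = ev v x} -> u = v) &
      exists C : R, forall u, (Lnu_norm mu nu (ev u) <= (C * `|u|)%:E)%E].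

End spaces.

Section domains.
Variables (R : realType) (d : nat).

Definition boundary (Omega : set 'cV[R]_d) : set 'cV[R]_d :=
  closure Omega `\` Omega°.

(* After an orthogonal change of coordinates Q, Omega is near each boundary point
   the set above the graph of a Lipschitz function of the coordinates other
   than the i-th. *)
Definition lipschitz_boundary (Omega : set 'cV[R]_d) : Prop :=
  forall z, boundary Omega z ->
  exists (Q : 'M[R]_d) (i : 'I_d) (g : 'cV[R]_d.-1 -> R),
    [/\ Q *m Q^T = 1%:M, lipschitz (g : 'cV[R]_d.-1 -> R^o) &
        \forall x \near z, Omega x <-> g (row' i (Q *m x)) < (Q *m x) i 0].

End domains.

Section derivatives.
Variables (R : realType) (d c : nat).
Implicit Types (f : 'cV[R]_d -> 'cV[R]_c) (Omega : set 'cV[R]_d).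

Definition partial (i : 'I_d) f : 'cV[R]_d -> 'cV[R]_c :=
  fun x => 'D_(delta_mx i 0) f x.

Definition partials (s : seq 'I_d) f := foldr partial f s.

Definition Ck_open (k : nat) Omega f : Prop :=
  forall s : seq 'I_d, (size s <= k)%N ->
    {within Omega, continuous (partials s f)} /\
    ((size s < k)%N -> forall i x, Omega x ->
       derivable (partials s f) x (delta_mx i 0)).

Definition Ck_closure (k : nat) Omega f : Prop :=
  [/\ Ck_open k Omega f,
      {within closure Omega, continuous f} &
      forall s : seq 'I_d, (size s <= k)%N ->
        exists g : 'cV[R]_d -> 'cV[R]_c,
          {within closure Omega, continuous g} /\
          forall x, Omega x -> g x = partials s f x].

Definition multi_index (r : nat) : Type :=
  {b : {ffun 'I_d -> 'I_r.+1} | (\sum_i b i <= r)%N}.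

Definition Dmulti (r : nat) (b : multi_index r) f : 'cV[R]_d -> 'cV[R]_c :=
  partials (flatten [seq nseq (val b i) i | i <- enum 'I_d]) f.

Definition boundary_value Omega f (z : 'cV[R]_d) : 'cV[R]_c :=
  lim (f @ within Omega (nbhs z)).

Definition interior_jet (r : nat) f z : multi_index r -> 'cV[R]_c :=
  fun b => Dmulti b f z.

Definition boundary_jet Omega (r : nat) f z : multi_index r -> 'cV[R]_c :=
  fun b => boundary_value Omega (Dmulti b f) z.

Definition local_operator (r : nat) (A : set 'cV[R]_d)
    (jet : ('cV[R]_d -> 'cV[R]_c) -> 'cV[R]_d -> multi_index r -> 'cV[R]_c)
    (X Y : Type) (m : nat) (evX : X -> 'cV[R]_d -> 'cV[R]_c)
    (evY : Y -> 'cV[R]_d -> 'cV[R]_m) (op : X -> Y) : Prop :=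
  exists F : 'cV[R]_d -> (multi_index r -> 'cV[R]_c) -> 'cV[R]_m,
    forall u z, A z -> evY (op u) z = F z (jet (evX u) z).

End derivatives.

Section networks.
Variables (R : realType) (d c : nat).

Definition Ck_real (k : nat) (sigma : R -> R) : Prop :=
  (forall j x, (j < k)%N -> derivable (derive1n j sigma) x 1) /\
  continuous (derive1n k sigma).

Definition shallow_networks (sigma : R -> R) (m : nat) :
    set ('cV[R]_d -> 'cV[R]_c) :=
  [set f | exists (W1 : 'M[R]_(m, d)) (b1 : 'cV[R]_m)
                  (W2 : 'M[R]_(c, m)) (b2 : 'cV[R]_c),
             f = fun x => W2 *m map_mx sigma (W1 *m x + b1) + b2].

End networks.

Definition argmin (R : realType) (X : Type) (S : set X) (J : X -> R) : set X :=
  [set u | S u /\ forall v, S v -> J u <= J v].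

(* Main.v *)
Require Import Defs.
From HB Require Import structures.
From mathcomp Require Import all_boot all_order all_algebra finmap.
From mathcomp Require Import all_classical all_reals all_analysis.
From mathcomp Require Import zify ring.

Set Implicit Arguments.
Unset Strict Implicit.
Unset Printing Implicit Defensive.

Import Order.TTheory GRing.Theory Num.Theory.
Import numFieldNormedType.Exports.

Local Open Scope classical_set_scope.
Local Open Scope ring_scope.

(** The functional J only sees u through its jets at the interior nodes, through
    the boundary values of its jets at the boundary nodes, and through its
    values at these nodes.  So everything follows from one fact: the networks
    of the given width interpolate arbitrary jets at the nodes
    ([network_matching_jets]).  Every u in U then has a companion network with
    the same value of J and the same node values.  The infima of J over U and
    over the networks thus agree, which gives both claims.

    For the interpolation, write the jet conditions as pairs i = (p, b) of a
    node z_p of order r_p and a multi-index b with |b| <= r_p.  The neuron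
    sigma (w . x + a) satisfies condition i with the value
        T(w)_i = w^b sigma^(|b|) (w . z_p + a).
    With as many neurons as conditions the task is a square linear system, and
    it is solvable for suitable inner weights once the vectors T(w) span the
    whole space ([unitmx_rows_in]).  The same neurons serve all the components
    of the output, so only outer weights depend on the component.

    The spanning property is proved by duality.  Suppose a functional lambda
    kills T(w) for all w.  Replacing w by t w and expanding at t = 0, the
    coefficient of t^m is sigma^(m)(a) / m! times the value of lambda on the
    ridge monomial (w . x)^m.  Since sigma^(m)(a) is nonzero, lambda kills
    (w . x)^m for all m <= n ([activation_moments]).  The function w^b
    sigma^(|b|) (t w . z + a) is only n - |b| times differentiable in t, but
    the factor t^|b| makes up for the missing orders; hence the use of Peano
    remainders instead of derivatives in t.

    If w separates the nodes, then on functions of w . x the functional is a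
    univariate one, and univariate Hermite interpolation shows that
    sum_(|b| = k) lambda_(p,b) w^b = 0 for all p and k ([ridge_coef_eq0]).
    Substituting w_j = y^(B^j) with a large base B turns this sum into a
    polynomial in y whose exponents are distinct, and likewise turns the
    separation of two nodes into the nonvanishing of a nonzero polynomial;
    hence lambda = 0 ([ridge_functional_eq0]).

    It remains to count.  A node of order r carries C(d + r, d) conditions, and
    C(., d) is superadditive, so there are at most C(ell, d) conditions; and the
    sum of the r_p + 1 is at most n + 1 for n = ell - d, which is what Hermite
    interpolation by polynomials of degree n requires. *)

(** * Univariate Hermite interpolation in dual form *)

Lemma derivn_mul_exp_XsubC (R : comNzRingType) (s : R) (g : {poly R}) m k :
  (k <= m)%N ->
  exists2 h, (('X - s%:P) ^+ m * g)^`(k) = ('X - s%:P) ^+ (m - k) * h &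
             h.[s] = (m ^_ k)%:R * g.[s].
Proof.
elim: k => [|k IHk] km; first by exists g; rewrite ?derivn0 ?subn0// ffactn0 mul1r.
have [h eh hs] := IHk (ltnW km).
exists (h *+ (m - k) + ('X - s%:P) * h^`()).
  rewrite derivnS eh derivM deriv_exp derivXsubC mul1r subnS.
  case: (m - k)%N (subn_gt0 k m) => [|j]; first by rewrite km.
  by move=> _ /=; rewrite exprS mulrnAl mulrDr mulrnAr mulrCA mulrA.
by rewrite !hornerE subrr mul0r addr0 hornerMn hs ffactnSr natrM -mulr_natr mulrAC.
Qed.

Lemma size_prod_exp_XsubC (R : idomainType) (I : finType) (Q : pred I)
    (s : I -> R) (e : I -> nat) :
  size (\prod_(i | Q i) ('X - (s i)%:P) ^+ e i) = (\sum_(i | Q i) e i).+1.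
Proof.
elim/big_rec2: _ => [|i m p _ IH]; first by rewrite size_poly1.
have p0 : p != 0 by rewrite -size_poly_gt0 IH.
by rewrite size_monicM ?rpredX ?monicXsubC// size_exp_XsubC IH addSn addnS.
Qed.

(** The coefficient [mu p k] is isolated by testing against the polynomial that
    vanishes to order k at [s p] and to full order at the other points.  It
    still sees the coefficients of order above k at [s p], so the induction
    goes downwards from order [r p]. *)
Lemma hermite_functional_eq0 (R : numFieldType) (P : finType) (s : P -> R)
    (r : P -> nat) (n : nat) (mu : P -> nat -> R) :
  injective s -> (\sum_p (r p).+1 <= n.+1)%N ->
  (forall q : {poly R}, (size q <= n.+1)%N ->
    \sum_p \sum_(k < (r p).+1) mu p k * q^`(k).[s p] = 0) ->
  forall p k, (k <= r p)%N -> mu p k = 0.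
Proof.
move=> s_inj rn mu0 p.
suff H j : (j <= r p)%N -> mu p (r p - j)%N = 0.
  by move=> k kr; rewrite -(subKn kr) H// leq_subr.
elim/ltn_ind: j => j IH jr; set k := (r p - j)%N.
have kr : (k <= r p)%N by rewrite leq_subr.
pose g := \prod_(p' | p' != p) ('X - (s p')%:P) ^+ (r p').+1 : {poly R}.
pose q := ('X - (s p)%:P) ^+ k * g.
have szq : (size q <= n.+1)%N.
  have g0 : g != 0 by rewrite -size_poly_gt0 size_prod_exp_XsubC.
  rewrite size_monicM ?rpredX ?monicXsubC// size_exp_XsubC.
  rewrite size_prod_exp_XsubC addSn addnS/= (leq_trans _ rn)//.
  by rewrite [leqRHS](bigD1 p)//= -addSn leq_add.
have gs : g.[s p] != 0.
  rewrite horner_prod; apply/prodf_neq0 => p' p'p.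
  by rewrite !hornerE expf_neq0// subr_eq0 (inj_eq s_inj) eq_sym.
have := mu0 _ szq; rewrite (bigD1 p)//= [X in _ + X]big1 ?addr0; last first.
  move=> p' p'p; rewrite big1// => i _.
  rewrite /q /g (bigD1 p')//= mulrCA.
  have [h -> _] := derivn_mul_exp_XsubC (s p')
    (('X - (s p)%:P) ^+ k * \prod_(i0 | (i0 != p) && (i0 != p'))
       ('X - (s i0)%:P) ^+ (r i0).+1) (ltnW (ltn_ord i)).
  rewrite hornerM horner_exp hornerXsubC subrr expr0n subn_eq0 leqNgt ltn_ord.
  by rewrite mul0r mulr0.
have kr1 : (k < (r p).+1)%N by [].
rewrite (bigD1 (Ordinal kr1))//= [X in _ + X]big1 ?addr0; last first.
  move=> i ik; have [ik'|ik'|ik'] := ltngtP i k.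
  - have [h -> _] := derivn_mul_exp_XsubC (s p) g (ltnW ik').
    rewrite hornerM horner_exp hornerXsubC subrr expr0n subn_eq0 leqNgt ik'.
    by rewrite mul0r mulr0.
  - have ir : (i <= r p)%N by rewrite -ltnS.
    rewrite -(subKn ir) IH ?mul0r ?leq_subr// ltn_subLR//.
    by move: ik'; rewrite /k ltn_subLR// addnC.
  - by move/eqP: ik; case; exact: val_inj.
have [h -> hs] := derivn_mul_exp_XsubC (s p) g (leqnn k).
rewrite subnn expr0 mul1r hs ffactnn => /eqP; rewrite !mulf_eq0 (negPf gs).
by rewrite pnatr_eq0 eqn0Ngt fact_gt0/= orbF => /eqP.
Qed.

(** * Functionals vanishing on ridge polynomials *)

Lemma positional_inj (B d : nat) (b b' : 'I_d -> nat) :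
  (forall i, (b i < B)%N) -> (forall i, (b' i < B)%N) ->
  (\sum_i b i * B ^ i = \sum_i b' i * B ^ i)%N -> b =1 b'.
Proof.
elim: d b b' => [|d IH] b b' bB b'B; first by move=> _ [].
have shift (c : 'I_d.+1 -> nat) :
    (\sum_i c i * B ^ i = (\sum_i c (lift ord0 i) * B ^ i) * B + c ord0)%N.
  rewrite big_ord_recl muln1 addnC big_distrl; congr (_ + _)%N.
  by apply: eq_bigr => i _; rewrite expnSr mulnA.
rewrite !shift => e i.
have B0 : (0 < B)%N by exact: leq_trans (bB i).
have e0 : b ord0 = b' ord0.
  by move/(congr1 (modn^~ B)): e; rewrite !modnMDl !modn_small.
have [j ->|->] := unliftP ord0 i; last exact: e0.
apply: (IH (b \o lift ord0) (b' \o lift ord0)) => [j'|j'|] /=;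
  [exact: bB|exact: b'B|].
by apply/eqP; rewrite -(eqn_pmul2r B0) -(eqn_add2r (b ord0)) [in eqbRHS]e0; apply/eqP.
Qed.

Lemma poly_fun_eq0 (R : numDomainType) (p : {poly R}) :
  (forall x, p.[x] = 0) -> p = 0.
Proof.
move=> p0; apply: (@roots_geq_poly_eq0 _ _ [seq i%:R | i <- iota 0 (size p)]).
- by apply/allP => x _; apply/rootP.
- by rewrite map_inj_uniq ?iota_uniq//; move=> i j /eqP; rewrite eqr_nat => /eqP.
- by rewrite size_map size_iota.
Qed.

Definition monom (R : pzRingType) (d : nat) (w : 'rV[R]_d) (b : 'I_d -> nat) : R :=
  \prod_j w 0 j ^+ b j.

(** The jet conditions are indexed by an abstract type [I]: condition [i] is the
    derivative of multi-index [expo i] at the node [z (node i)].  Applied to the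
    ridge monomial (w . x)^m it gives w^b (m)_|b| (w . z)^(m - |b|), where (m)_k
    is the falling factorial; it vanishes for m < |b|, which makes the truncated
    exponent harmless. *)
Section ridge.
Variables (R : numFieldType) (d n : nat) (P I : finType).
Variables (z : P -> 'cV[R]_d) (r : P -> nat).
Variables (node : I -> P) (expo : I -> {ffun 'I_d -> nat}).
Hypothesis z_inj : injective z.
Hypothesis expo_le : forall i, (\sum_j expo i j <= r (node i))%N.
Hypothesis jet_inj : injective (fun i => (node i, expo i)).
Hypothesis orders_le : (\sum_p (r p).+1 <= n.+1)%N.

Let deg i := (\sum_j expo i j)%N.
Let dot (w : 'rV[R]_d) p : R := (w *m z p) 0 0.

(** Along a direction separating the nodes, the functional becomes a univariate
    Hermite functional at the points w . z_p.  Its coefficient of order k at p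
    gathers all the multi-indices of length k. *)
Lemma ridge_coef_eq0 (lambda : I -> R) (w : 'rV[R]_d) :
  (forall m, (m <= n)%N -> \sum_i lambda i * monom w (expo i) *
     ((m ^_ deg i)%:R * dot w (node i) ^+ (m - deg i)) = 0) ->
  injective (dot w) ->
  forall p k, (k <= r p)%N ->
    \sum_(i | (node i == p) && (deg i == k)) lambda i * monom w (expo i) = 0.
Proof.
move=> H w_inj.
apply: (hermite_functional_eq0 w_inj orders_le
  (mu := fun p k =>
     \sum_(i | (node i == p) && (deg i == k)) lambda i * monom w (expo i))).
move=> q szq.
transitivity (\sum_i lambda i * monom w (expo i) * q^`(deg i).[dot w (node i)]).
  rewrite [RHS](partition_big node predT)//=; apply: eq_bigr => p _.
  rewrite [RHS](partition_big (fun i => inord (deg i) : 'I_(r p).+1) predT)//=.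
  apply: eq_bigr => k _; rewrite mulr_suml.
  apply: eq_big => [i|i /andP[/eqP -> /eqP -> //]].
  apply: andb_id2l => /eqP ip; rewrite -val_eqE/= inordK// ltnS -ip.
  exact: expo_le.
rewrite -(coefK q) poly_def.
under eq_bigr => i _.
  rewrite linear_sum horner_sum mulr_sumr; over.
rewrite exchange_big/= big1// => m _.
have mn : (m <= n)%N by rewrite -ltnS (leq_trans (ltn_ord m)).
rewrite -[RHS](mulr0 q`_m) -[X in _ = _ * X](H m mn) mulr_sumr; apply: eq_bigr => i _.
rewrite derivnZ derivnXn hornerZ hornerMn hornerXn -[_ *+ _]mulr_natl.
by rewrite mulrCA.
Qed.

(** Kronecker substitution: along the curve w_j = y^(B^j) distinct multi-indices
    below the base B give distinct powers of y.  All conditions become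
    polynomial in y, and a product of polynomials that vanishes at every point
    has a zero factor. *)
Lemma ridge_functional_eq0 (lambda : I -> R) :
  (forall (w : 'rV[R]_d) m, (m <= n)%N -> \sum_i lambda i * monom w (expo i) *
     ((m ^_ deg i)%:R * dot w (node i) ^+ (m - deg i)) = 0) ->
  forall i, lambda i = 0.
Proof.
move=> H i0.
(* All the exponents are at most n, and B must exceed 1 for the powers B^j of
   the linear forms D to be distinct. *)
pose B := n.+2; pose w (y : R) : 'rV[R]_d := \row_j y ^+ (B ^ j).
pose L := \sum_(i | (node i == node i0) && (deg i == deg i0))
  lambda i *: 'X^(\sum_j expo i j * B ^ j) : {poly R}.
pose D (pq : P * P) := \sum_j (z pq.1 - z pq.2) j 0 *: 'X^(B ^ j) : {poly R}.
have expo_lt i j : (expo i j < B)%N.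
  apply: (@leq_trans n.+1) => //; rewrite ltnS.
  apply: (@leq_trans (deg i)); first by rewrite /deg (bigD1 j)//= leq_addr.
  apply: leq_trans (expo_le i) _; rewrite -ltnS (leq_trans _ orders_le)//.
  by rewrite (bigD1 (node i))//= leq_addr.
have D0 pq : pq.1 != pq.2 -> D pq != 0.
  apply: contraNneq => D0; apply/eqP/z_inj/colP => j.
  apply/eqP; rewrite -subr_eq0.
  have := congr1 (fun p : {poly R} => p`_(B ^ j)) D0.
  rewrite coef0 /D coef_sum (bigD1 j)//= coefZ coefXn eqxx mulr1 big1 ?addr0.
    by rewrite !mxE => ->.
  move=> j' j'j; rewrite coefZ coefXn eqn_exp2l// (inj_eq val_inj) eq_sym.
  by rewrite (negPf j'j) mulr0.
have DE y p q : (D (p, q)).[y] = dot (w y) p - dot (w y) q.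
  rewrite /D /dot horner_sum !mxE -sumrB; apply: eq_bigr => j _.
  by rewrite !mxE hornerZ hornerXn mulrC mulrBr.
have LE y : L.[y] = \sum_(i | (node i == node i0) && (deg i == deg i0))
    lambda i * monom (w y) (expo i).
  rewrite /L horner_sum; apply: eq_bigr => i _; rewrite hornerZ hornerXn.
  congr (_ * _); rewrite -prodrXr; apply: eq_bigr => j _.
  by rewrite !mxE -exprM mulnC.
(* At each y either two nodes have the same image and some D vanishes, or the
   direction w y separates the nodes and L vanishes. *)
have : L * \prod_(pq | pq.1 != pq.2) D pq = 0.
  apply: poly_fun_eq0 => y; rewrite hornerM horner_prod.
  have [->|] := eqVneq (\prod_(pq | pq.1 != pq.2) (D pq).[y]) 0.
    by rewrite mulr0.
  move=> /prodf_neq0 Dy; rewrite LE ridge_coef_eq0 ?mul0r//; last exact: expo_le.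
    exact: H.
  move=> p q pq; apply/eqP/negPn/negP => npq.
  by have := Dy (p, q) npq; rewrite DE pq subrr eqxx.
move/eqP; rewrite mulf_eq0 => /orP[/eqP L0|]; last first.
  by move=> /eqP E; have /prodf_neq0/eqP := D0; rewrite E.
have := congr1 (fun p : {poly R} => p`_(\sum_j expo i0 j * B ^ j)) L0.
rewrite coef0 /L coef_sum (bigD1 i0) ?eqxx//= coefZ coefXn eqxx mulr1 big1 ?addr0//.
move=> i /andP[/andP[/eqP ni _]] ii0; rewrite coefZ coefXn.
case: eqP => [/esym e|_]; last by rewrite mulr0.
case/eqP: ii0; apply: jet_inj; congr (_, _) => //.
apply/ffunP; exact: positional_inj e.
Qed.

End ridge.

(** * Taylor expansion with Peano remainder *)

Section flat.
Variable R : realType.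
Implicit Types (phi : R -> R) (N : nat).

(** This is phi(t) = o(t^N) as t tends to 0. *)
Definition flat N phi :=
  forall e : R, 0 < e -> \forall t \near (0 : R), `|phi t| <= e * `|t| ^+ N.

Lemma flatM N k phi : flat N phi -> flat (N + k) (fun t => t ^+ k * phi t).
Proof.
move=> H e /H; apply: filterS => t ht.
by rewrite normrM normrX exprD mulrA [leRHS]mulrC ler_wpM2l// exprn_ge0.
Qed.

Lemma flatZ N (c : R) phi : flat N phi -> flat N (fun t => c * phi t).
Proof.
move=> H e e0; have c1 : 0 < `|c| + 1 by rewrite ltr_wpDl.
have /H : 0 < e / (`|c| + 1) by rewrite divr_gt0.
apply: filterS => t ht; rewrite normrM.
apply: le_trans (ler_wpM2l (normr_ge0 c) ht) _.
rewrite mulrA ler_wpM2r ?exprn_ge0// mulrCA ler_piMr ?(ltW e0)//.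
by rewrite ler_pdivrMr// mul1r lerDl.
Qed.

Lemma flat_sum (I : finType) N (phi : I -> R -> R) :
  (forall i, flat N (phi i)) -> flat N (fun t => \sum_i phi i t).
Proof.
move=> H e e0.
have I0 : 0 < #|I|%:R + 1 :> R by rewrite ltr_wpDl.
have e'0 : 0 < e / (#|I|%:R + 1) by rewrite divr_gt0.
have : \forall t \near (0:R), forall i, `|phi i t| <= e / (#|I|%:R + 1) * `|t| ^+ N.
  by apply: (filter_forall (F := nbhs (0:R))) => i; exact: H.
apply: filterS => t ht; apply: le_trans (ler_norm_sum _ _ _) _.
apply: le_trans (ler_sum _ (fun i _ => ht i)) _.
rewrite sumr_const -[_ *+ _]mulr_natl mulrA ler_wpM2r ?exprn_ge0//.
by rewrite mulrCA ler_piMr ?(ltW e0)// ler_pdivrMr// mul1r lerDl.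
Qed.

Lemma flat_dilation N (c : R) phi : flat N phi -> flat N (fun t => phi (c * t)).
Proof.
move=> H e e0; have c1 : 0 < `|c| ^+ N + 1 by rewrite ltr_wpDl// exprn_ge0.
have e'0 : 0 < e / (`|c| ^+ N + 1) by rewrite divr_gt0.
have ct : c * t @[t --> (0:R)] --> 0.
  by rewrite -[X in _ --> X](mulr0 c); exact: mulrl_continuous.
have := ct _ (H _ e'0); apply: (filterS (F := nbhs (0:R))) => t /= ht.
apply: le_trans ht _; rewrite normrM exprMn mulrA ler_wpM2r ?exprn_ge0//.
rewrite -mulrA ler_piMr ?(ltW e0)//.
by rewrite mulrC ler_pdivrMr// mul1r lerDl.
Qed.

End flat.

Section peano.
Variable R : realType.
Implicit Types (f g : R -> R) (a e t : R) (N : nat).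

Lemma mean_value_bound f f' t : (forall x : R, is_derive x 1 f (f' x)) ->
  exists2 c, `|c| <= `|t| & `|f t - f 0| <= `|f' c| * `|t|.
Proof.
move=> df.
have cf : continuous f.
  by move=> x; apply/differentiable_continuous/derivable1_diffP; exact: ex_derive.
have [t0|t0] := leP 0 t.
  have [//|c c0t ->] := MVT_segment t0 (fun x _ => df x).
    exact: continuous_subspaceT.
  exists c; last by rewrite subr0 normrM.
  by move: c0t; rewrite in_itv/= => /andP[c0 ct]; rewrite !ger0_norm.
have [//|c ct0 ft] := MVT_segment (ltW t0) (fun x _ => df x).
  exact: continuous_subspaceT.
exists c; last by rewrite distrC ft sub0r normrM normrN.
move: ct0; rewrite in_itv/= => /andP[tc c0].
by rewrite !ler0_norm ?lerN2// ltW.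
Qed.

Definition taylor_poly g a N : {poly R} :=
  \poly_(j < N.+1) (g^`(j)%classic a / j`!%:R).

Lemma deriv_taylor_poly g a N :
  (taylor_poly g a N.+1)^`()%R = taylor_poly (g^`())%classic a N.
Proof.
apply/polyP => j; rewrite coef_deriv !coef_poly ltnS.
case: ifPn => jN; last by rewrite mul0rn.
rewrite derive1Sn -[LHS]mulr_natr factS natrM invfM -mulrA; congr (_ * _).
by rewrite mulrAC mulVf ?mul1r// pnatr_eq0.
Qed.

Lemma taylor_poly0 g a N : (taylor_poly g a N).[0] = g a.
Proof. by rewrite horner_coef0 coef_poly/= fact0 divr1. Qed.

(** The remainder vanishes at 0 and its derivative is the remainder of the
    derivative of g at order one less, so the mean value theorem gives the
    induction step. *)
Lemma taylor_peano g a N :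
  (forall j x, (j < N)%N -> derivable (g^`(j))%classic x 1) ->
  {for a, continuous (g^`(N))%classic} ->
  flat N (fun t => g (a + t) - (taylor_poly g a N).[t]).
Proof.
elim: N g => [|N IH] g dg cg e e0.
  have : g (a + t) @[t --> (0:R)] --> g a.
    have : {for a + 0, continuous g} by rewrite addr0.
    move=> cg'; rewrite -[X in _ --> g X]addr0.
    apply: continuous_comp; last exact: cg'.
    by apply: cvgD; [exact: cvg_cst|exact: cvg_id].
  move/cvgrPdist_le => /(_ e e0); apply: filterS => t.
  by rewrite distrC /taylor_poly poly_def big_ord1 hornerZ hornerXn !expr0 !mulr1 fact0 divr1.
have dg1 x : derivable g x 1 by apply: (dg 0%N).
have := IH (g^`())%classic; move=> /(_ _ _ e e0).
have H1 j x : (j < N)%N -> derivable ((g^`())^`(j))%classic x 1.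
  by move=> jN; rewrite -derive1Sn; exact: dg.
move=> /(_ H1); rewrite -derive1Sn => /(_ cg) /nbhs_norm0P[dl /= dl0 near_g'].
apply/nbhs_norm0P; exists dl => //= t td.
have drho (x : R) : is_derive x 1 (fun t => g (a + t) - (taylor_poly g a N.+1).[t])
    (g^`()%classic (a + x) - (taylor_poly (g^`())%classic a N).[x]).
  rewrite -deriv_taylor_poly.
  have dgx : is_derive (a + x) 1 g (g^`()%classic (a + x)).
    by rewrite derive1E; exact/derivableP.
  have dax : is_derive x 1 (fun t => a + t) 1.
    have := is_deriveD (is_derive_cst a x 1) (is_derive_id x 1).
    by rewrite add0r.
  have := is_derive1_comp dgx dax; rewrite mulr1 => dcomp.
  by apply: is_deriveB.
have [c ct] := mean_value_bound t drho.
rewrite addr0 taylor_poly0 subrr subr0 => /le_trans; apply.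
rewrite exprSr mulrA ler_wpM2r//.
rewrite (le_trans (near_g' c _))//=; first by rewrite (le_lt_trans ct).
by rewrite ler_wpM2l ?(ltW e0)// lerXn2r ?nnegrE.
Qed.

(** Dividing q by the exact power t^m of t leaves a polynomial with a nonzero
    value at 0, so q is not o(t^N) for N >= m. *)
Lemma flat_poly_eq0 (q : {poly R}) N : (size q <= N.+1)%N ->
  flat N (horner q) -> q = 0.
Proof.
move=> szq H; apply/eqP/negPn/negP => q0.
have [m [g]] := multiplicity_XsubC q 0; rewrite q0 /= => g0 qE.
have mN : (m <= N)%N.
  have gn0 : g != 0 by apply: contraNneq g0 => ->; rewrite root0.
  have := szq; rewrite qE size_Mmonic ?rpredX ?monicXsubC// size_exp_XsubC.
  rewrite addnS/= => /(leq_trans _) sz; rewrite -ltnS sz//.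
  by rewrite -addn1 addnC leq_add2r size_poly_gt0.
have : 0 < `|g.[0]| by rewrite normr_gt0; exact: g0.
set y := `|g.[0]| => y0.
have y2 : 0 < y / 2 by rewrite divr_gt0.
have /cvgrPdist_lt/(_ _ y2) hg := @continuous_horner R g 0.
(* For t in ]0, 1], t^N <= t^m, hence |g t| <= y / 2 while |g 0| = y. *)
near (0 : R)^'+ => t.
have t0 : 0 < t by near: t; exact: nbhs_right_gt.
have t1 : t <= 1 by near: t; exact: nbhs_right_le.
have qt : `|q.[t]| <= y / 2 * `|t| ^+ N by near: t; apply: cvg_within; exact: H.
have gt : `|g.[0] - g.[t]| < y / 2 by near: t; apply: cvg_within; exact: hg.
move: qt; rewrite qE subr0 hornerM horner_exp hornerX normrM normrX !(gtr0_norm t0).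
apply/negP; rewrite -ltNge (@le_lt_trans _ _ (y / 2 * t ^+ m))//.
  by rewrite ler_wpM2l ?ler_wiXn2l ?(ltW y2) ?(ltW t0).
rewrite ltr_pM2r ?exprn_gt0//.
have : y < y / 2 + `|g.[t]|.
  apply: (@le_lt_trans _ _ (`|g.[0] - g.[t]| + `|g.[t]|)); last by rewrite ltrD2r.
  by rewrite /y -{1}(subrK g.[t] g.[0]) ler_normD.
by rewrite [in ltLHS](splitr y) ltrD2l.
Unshelve. all: by end_near. Qed.

End peano.

Lemma derive1nD (R : realType) (f : R -> R) k j :
  ((f^`(k))^`(j) = f^`(k + j))%classic.
Proof. by rewrite /derive1n addnC iterD. Qed.

(** * Functionals vanishing on ridge functions *)

Section activation.
Variables (R : realType) (d n : nat) (P I : finType).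
Variables (z : P -> 'cV[R]_d) (node : I -> P) (expo : I -> {ffun 'I_d -> nat}).
Variables (sigma : R -> R) (a : R).
Hypothesis sigma_Cn : Ck_real n sigma.
Hypothesis sigma_neq0 : forall k, (k <= n)%N -> derive1n k sigma a != 0.

Let deg i := (\sum_j expo i j)%N.
Let dot (w : 'rV[R]_d) p : R := (w *m z p) 0 0.
Hypothesis deg_le : forall i, (deg i <= n)%N.

Lemma monomZ (t : R) (w : 'rV[R]_d) i :
  monom (t *: w) (expo i) = t ^+ deg i * monom w (expo i).
Proof.
rewrite /monom /deg -prodrXr -big_split/=.
by apply: eq_bigr => j _; rewrite mxE exprMn.
Qed.

Lemma taylor_dilation (g : R -> R) N (c t : R) :
  (\poly_(j < N.+1) ((taylor_poly g a N)`_j * c ^+ j)).[t] =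
  (taylor_poly g a N).[c * t].
Proof.
rewrite horner_poly (horner_coef_wide _ (size_poly _ _)).
by apply: eq_bigr => j _; rewrite exprMn mulrA.
Qed.

(** Along the line t w, the hypothesis is the vanishing of a sum of terms
    t^|b| sigma^(|b|) (a + t w . z).  Expanding the last factor to order n - |b|
    makes each term a polynomial in t up to o(t^n); the resulting polynomial has
    degree at most n, hence is zero, and its coefficient of order m is
    sigma^(m)(a) / m! times the claimed sum. *)
Lemma activation_moments (lambda : I -> R) :
  (forall w : 'rV[R]_d, \sum_i lambda i * (monom w (expo i) *
     derive1n (deg i) sigma (a + dot w (node i))) = 0) ->
  forall (w : 'rV[R]_d) m, (m <= n)%N -> \sum_i lambda i * monom w (expo i) *
     ((m ^_ deg i)%:R * dot w (node i) ^+ (m - deg i)) = 0.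
Proof.
move=> H w m mn.
pose g i := (sigma^`(deg i))%classic.
pose N i := (n - deg i)%N; pose c i := dot w (node i).
pose q := \sum_i (lambda i * monom w (expo i)) *:
  ('X^(deg i) * \poly_(j < (N i).+1) ((taylor_poly (g i) a (N i))`_j * c i ^+ j)).
have q0 : q = 0.
  apply: (@flat_poly_eq0 R q n).
    rewrite (leq_trans (size_sum _ _ _))//; apply/bigmax_leqP => i _.
    rewrite (leq_trans (size_scale_leq _ _))// (leq_trans (size_polyMleq _ _))//.
    rewrite size_polyXn addSn/= (leq_trans (leq_add (leqnn _) (size_poly _ _)))//.
    by rewrite addnS subnKC.
  rewrite (_ : horner q = fun t => \sum_i (- (lambda i * monom w (expo i))) *
     (t ^+ deg i * (g i (a + c i * t) - (taylor_poly (g i) a (N i)).[c i * t]))); last first.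
    apply/funext => t; rewrite -[LHS](subr0 _) -[X in _ - X](H (t *: w)).
    rewrite /q horner_sum -sumrB; apply: eq_bigr => i _.
    rewrite hornerZ hornerM hornerXn taylor_dilation monomZ.
    have -> : dot (t *: w) (node i) = c i * t by rewrite /dot -scalemxAl mxE mulrC.
    by rewrite -/(g i); ring.
  apply: flat_sum => i; apply: flatZ; rewrite -(subnK (deg_le i)); apply: flatM.
  apply: (@flat_dilation _ _ (c i) (fun t => g i (a + t) - (taylor_poly (g i) a (N i)).[t])).
  case: sigma_Cn => dsigma csigma.
  apply: taylor_peano => [j x jN|]; rewrite /g derive1nD.
    by apply: dsigma; rewrite -ltn_subRL.
  by rewrite subnKC//; exact: csigma.
have := congr1 (fun p : {poly R} => p`_m) q0; rewrite coef0 /q coef_sum.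
have sm0 : derive1n m sigma a / m`!%:R != 0.
  by rewrite mulf_neq0 ?sigma_neq0// invr_eq0 pnatr_eq0 -lt0n fact_gt0.
move=> E; apply: (mulfI sm0); rewrite mulr0 -[RHS]E mulr_sumr; apply: eq_bigr => i _.
rewrite coefZ coefXnM coef_poly coef_poly.
have [mi|im] := ltnP m (deg i); first by rewrite ffact_small// mul0r !mulr0.
rewrite ltnS leq_sub2r// -(ffact_fact im) natrM derive1nD subnKC//.
have f1 : (m ^_ deg i)%:R != 0 :> R by rewrite pnatr_eq0 -lt0n ffact_gt0.
have f2 : ((m - deg i)`!)%:R != 0 :> R by rewrite pnatr_eq0 -lt0n fact_gt0.
by rewrite /c; field; rewrite f1 f2.
Qed.

End activation.

(** * Partial derivatives of networks *)

Lemma is_derive_scale (R : realType) (V W : normedModType R) (phi : V -> R)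
    (x v : V) (l : R) (y : W) :
  is_derive x v phi l -> is_derive x v (fun x => phi x *: y) (l *: y).
Proof.
move=> [dphi phil].
have H : h^-1 *: (phi (h *: v + x) *: y - phi x *: y) @[h --> 0^'] --> l *: y.
  under eq_fun do rewrite -scalerBl scalerA.
  by apply: cvgZr_tmp; rewrite -phil; exact: dphi.
split; first by apply/cvg_ex; exists (l *: y).
exact: cvg_lim.
Qed.

(** Reduces a directional derivative to a derivative in one real variable, where
    the chain rule for real functions applies. *)
Lemma is_derive_line (R : realType) (V W : normedModType R) (f : V -> W)
    (x v : V) (l : W) :
  is_derive (0 : R) 1 (fun t => f (t *: v + x)) l -> is_derive x v f l.
Proof.
move=> [df fl]; split; first exact: (proj2 (derivable1P f x v)).
rewrite -fl /derive; apply: (congr1 (fun q : R -> W => lim (q @ 0^'))).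
by apply/funext => h /=; rewrite scale0r add0r addr0 [h *: 1]mulr1.
Qed.

(** A network is handled as a sum of scalar ridge functions times fixed vectors:
    each partial derivative then multiplies the scalar factor of a neuron by one
    of its inner weights and differentiates its activation once more. *)
Section ridge_sums.
Variables (R : realType) (d c m n : nat) (sigma : R -> R).
Hypothesis sigma_Cn : Ck_real n sigma.
Variables (W1 : 'M[R]_(m, d)) (b1 : 'cV[R]_m) (v : 'I_m -> 'cV[R]_c).

Let pre (x : 'cV[R]_d) k : R := (W1 *m x + b1) k 0.

Lemma is_derive_ridge j k i x : (j < n)%N ->
  is_derive x (delta_mx i 0) (fun x => (sigma^`(j))%classic (pre x k))
    (W1 k i * (sigma^`(j.+1))%classic (pre x k)).
Proof.
case: sigma_Cn => dsigma _ jn; apply: is_derive_line.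
have preE t : pre (t *: delta_mx i 0 + x) k = t * W1 k i + pre x k.
  rewrite /pre mulmxDr -scalemxAr -addrA mxE; congr (_ + _).
  by rewrite mxE -colE mxE.
under eq_fun do rewrite preE.
have ds : is_derive (0 * W1 k i + pre x k) 1 (sigma^`(j))%classic
    ((sigma^`(j.+1))%classic (pre x k)).
  rewrite mul0r add0r derive1nS derive1E; exact/derivableP/dsigma.
have dl : is_derive (0 : R) 1 (fun t => t * W1 k i + pre x k) (W1 k i).
  have := is_deriveD (is_derive_scale (W1 k i) (is_derive_id (0:R) 1))
    (is_derive_cst (pre x k) (0:R) 1).
  by rewrite addr0 scale1r.
have := @is_derive1_comp _ (sigma^`(j))%classic
  (fun t => t * W1 k i + pre x k) 0 _ _ ds dl.
by rewrite mulrC.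
Qed.

Lemma partials_ridge_sum (s : seq 'I_d) : (size s <= n)%N ->
  partials s (fun x => \sum_k sigma (pre x k) *: v k) =
  fun x => \sum_k ((\prod_(i <- s) W1 k i) * (sigma^`(size s))%classic (pre x k)) *: v k.
Proof.
elim: s => [|i s IH] sn.
  by apply/funext => x; apply: eq_bigr => k _; rewrite big_nil mul1r.
rewrite [LHS]/= IH ?(ltnW sn)//; apply/funext => x; rewrite /partial.
apply: derive_val.
have H k : is_derive x (delta_mx i 0) (fun x =>
     ((\prod_(i <- s) W1 k i) * (sigma^`(size s))%classic (pre x k)) *: v k)
   (((\prod_(i <- i :: s) W1 k i) * (sigma^`(size (i :: s)))%classic (pre x k)) *: v k).
  apply: is_derive_scale; rewrite big_cons.
  have := is_deriveZ (\prod_(i <- s) W1 k i) (is_derive_ridge k i x sn).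
  by rewrite [_ *: _]mulrCA mulrA.
have := is_derive_sum H.
by rewrite (_ : \sum_(k < m) _ = fun x : 'cV[R]_d => \sum_k
  ((\prod_(i <- s) W1 k i) * (sigma^`(size s))%classic (pre x k)) *: v k)//;
  apply/funext => y; rewrite fct_sumE.
Qed.

Lemma continuous_sumfun (T : topologicalType) (E : normedModType R) (J : finType)
    (F : J -> T -> E) :
  (forall k, continuous (F k)) -> continuous (fun x => \sum_k F k x).
Proof.
move=> cF; rewrite (_ : (fun x => _) = \sum_k F k); last first.
  by apply/funext => x; rewrite fct_sumE.
apply: (big_ind (fun h : T -> E => continuous h)) => //.
  by move=> x; exact: cvg_cst.
by move=> f g cf cg x; apply: continuousD; [exact: cf|exact: cg].
Qed.

Lemma continuous_scale (T : topologicalType) (E : normedModType R)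
    (phi : T -> R) (y : E) :
  continuous phi -> continuous (fun x => phi x *: y).
Proof. by move=> cphi x; apply: cvgZr_tmp; exact: cphi. Qed.

Lemma continuous_preactivation k : continuous (pre^~ k).
Proof.
have preE : pre^~ k = fun x => \sum_j W1 k j * x j 0 + b1 k 0.
  by apply/funext => x; rewrite /pre !mxE.
rewrite preE => x; apply: (@continuousD _ _ _
  (fun x : 'cV[R]_d => \sum_j W1 k j * x j 0) (cst (b1 k 0))); last first.
  exact: cst_continuous.
apply: continuous_sumfun => j y.
by apply: (continuous_comp (coord_continuous (x := y))); exact: mulrl_continuous.
Qed.

Lemma continuous_partials_ridge_sum (s : seq 'I_d) : (size s <= n)%N ->
  continuous (partials s (fun x => \sum_k sigma (pre x k) *: v k)).
Proof.
case: sigma_Cn => dsigma csigma sn; rewrite partials_ridge_sum//.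
apply: continuous_sumfun => k; apply: continuous_scale => x.
have cs : {for pre x k, continuous (sigma^`(size s))%classic}.
  move: sn; rewrite leq_eqVlt => /predU1P[->|sn]; first exact: csigma.
  exact/differentiable_continuous/derivable1_diffP/dsigma.
have cg : {for pre x k, continuous
    (fun y => (\prod_(i <- s) W1 k i) * (sigma^`(size s))%classic y)}.
  by apply: (continuous_comp cs); exact: mulrl_continuous.
exact: (continuous_comp (@continuous_preactivation k x) cg).
Qed.

End ridge_sums.

Section germs.
Variables (R : realType) (d c : nat) (Omega : set 'cV[R]_d).
Hypothesis Omega_open : open Omega.
Implicit Types f g : 'cV[R]_d -> 'cV[R]_c.

Lemma eq_partials f g s : {in Omega, f =1 g} ->
  {in Omega, partials s f =1 partials s g}.
Proof.
move=> fg; elim: s => [|i s IH] //= x xO; apply: near_eq_derive.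
apply: filterS (open_nbhs_nbhs (conj Omega_open (set_mem xO))).
by move=> y Oy; apply: IH; exact: mem_set.
Qed.

Lemma boundary_value_continuous f z : closure Omega z ->
  f @ within Omega (nbhs z) --> f z -> boundary_value Omega f z = f z.
Proof. by move=> Oz cf; exact: cvg_lim. Qed.

Lemma eq_boundary_value f g z : {in Omega, f =1 g} ->
  boundary_value Omega f z = boundary_value Omega g z.
Proof.
move=> fg; rewrite /boundary_value; congr (lim _).
apply/seteqP; split; apply: (fmap_within_eq (F := nbhs z)) => x xO; by rewrite (fg _ xO).
Qed.

End germs.

(** * Hermite interpolation by networks *)

(** A set on which no nonzero functional vanishes spans, hence contains a basis:
    as long as the rows chosen are too few, some functional vanishes on them and
    not on the set, which provides one more independent row. *)
Lemma unitmx_rows_in (F : fieldType) (K : nat) (S : set 'rV[F]_K) :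
  (forall l : 'cV[F]_K, (forall v, S v -> v *m l = 0) -> l = 0) ->
  exists2 M : 'M[F]_K, M \in unitmx & forall k, S (row k M).
Proof.
move=> H.
suff E m : (m <= K)%N ->
    exists2 M : 'M[F]_(m, K), row_free M & forall k, S (row k M).
  have [M Mf SM] := E K (leqnn K).
  by exists M; rewrite -?row_free_unit.
elim: m => [|m IH] mK.
  by exists 0; [rewrite /row_free mxrank0|case].
have [M Mf SM] := IH (ltnW mK).
have [v Sv vM] : exists2 v, S v & ~~ (v <= M)%MS.
  apply: contrapT => nv.
  have MK : cokermx M != 0.
    rewrite -mxrank_eq0 mxrank_coker subn_eq0 -ltnNge.
    by move/eqP: Mf => ->.
  case/eqP: MK; apply/trmx_inj/row_matrixP => j; rewrite trmx0 row0.
  rewrite -tr_col (H (col j (cokermx M))) ?trmx0// => v Sv.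
  have vM : (v <= M)%MS by apply: contra_notT nv => vM; exists v.
  by move: vM; rewrite colE mulmxA submxE => /eqP ->; rewrite mul0mx.
exists (col_mx v M : 'M[F]_(1 + m, K)).
  have rE : \rank (col_mx v M) = \rank (v + M)%MS by rewrite addsmxE.
  rewrite /row_free eqn_leq rank_leq_row rE.
  have : (M < v + M)%MS.
    by rewrite /ltmx addsmxSr/= addsmx_sub submx_refl andbT.
  by rewrite ltmxErank => /andP[_]; move/eqP: Mf => ->.
move=> k; rewrite -[k](@splitK 1 m k); case: (@fintype.split 1 m k) => j /=.
  have vE : v = row (lshift m j) (col_mx v M).
    by rewrite rowKu; apply/rowP => i; rewrite mxE ord1.
  exact: (eq_ind _ S Sv _ vE).
have vE : row j M = row (rshift 1 j) (col_mx v M) by rewrite rowKd.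
exact: (eq_ind _ S (SM j) _ vE).
Qed.

HB.instance Definition _ d r := Finite.copy (multi_index d r)
  {b : {ffun 'I_d -> 'I_r.+1} | (\sum_i b i <= r)%N}.

(** Multi-indices of length at most r are the tuples counted by
    [card_partial_ord_partitions]. *)
Lemma card_multi_index d r : #|{: multi_index d r}| = 'C(d + r, d).
Proof.
rewrite card_sig -card_partial_ord_partitions.
rewrite -(card_imset _ (can_inj (@tuple_of_finfunK _ _))).
apply: eq_card => t; apply/imsetP/idP => [[b]|].
  rewrite !inE => br ->; rewrite big_tuple.
  by under eq_bigr do rewrite tnth_mktuple.
rewrite inE big_tuple => tr; exists (finfun_of_tuple t); last first.
  by rewrite finfun_of_tupleK.
by rewrite inE; under eq_bigr do rewrite ffunE.
Qed.

Section networks.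
Variables (R : realType) (d c : nat) (sigma : R -> R).

Lemma ridge_sum_shallow m (W1 : 'M[R]_(m, d)) (b1 : 'cV[R]_m) (W2 : 'M[R]_(c, m)) :
  shallow_networks sigma m
    (fun x : 'cV[R]_d => \sum_k sigma ((W1 *m x + b1) k 0) *: col k W2).
Proof.
exists W1, b1, W2, 0; apply/funext => x; apply/colP => l.
rewrite addr0 summxE mxE; apply: eq_bigr => k _.
by rewrite !mxE mulrC.
Qed.

Lemma shallow_networks_widen K m (f : 'cV[R]_d -> 'cV[R]_c) : (K <= m)%N ->
  shallow_networks sigma K f -> shallow_networks sigma m f.
Proof.
move=> /subnKC <- [W1 [b1 [W2 [b2 ->]]]].
exists (col_mx W1 0), (col_mx b1 0), (row_mx W2 0), b2; apply/funext => x.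
by rewrite mul_col_mx add_col_mx map_col_mx mul_row_col mul0mx addr0.
Qed.

End networks.

Section interpolation.
Variables (R : realType) (d c n : nat) (P : finType).
Variables (z : P -> 'cV[R]_d) (r : P -> nat) (sigma : R -> R) (a : R).
Hypothesis z_inj : injective z.
Hypothesis orders_le : (\sum_p (r p).+1 <= n.+1)%N.
Hypothesis sigma_Cn : Ck_real n sigma.
Hypothesis sigma_neq0 : forall k, (k <= n)%N -> derive1n k sigma a != 0.

Let directions r (b : multi_index d r) : seq 'I_d :=
  flatten [seq nseq (val b i) i | i <- enum 'I_d].

Lemma size_directions r' (b : multi_index d r') :
  size (directions b) = (\sum_j val b j)%N.
Proof.
rewrite size_flatten /shape -map_comp sumnE big_map big_enum/=.
by apply: eq_bigr => j _; rewrite size_nseq.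
Qed.

Lemma prod_directions r' (b : multi_index d r') (w : 'rV[R]_d) :
  \prod_(j <- directions b) w 0 j = monom w (fun j => val b j).
Proof.
rewrite big_flatten big_map big_enum/=; apply: eq_bigr => j _.
by rewrite big_nseq -Monoid.iteropE.
Qed.

Let I := {p : P & multi_index d (r p)}.
Let expo (i : I) : {ffun 'I_d -> nat} := [ffun j => val (val (tagged i) j)].

Lemma card_jets : #|{: I}| = (\sum_p 'C(d + r p, d))%N.
Proof.
rewrite card_tagged sumnE big_map big_enum/=.
by apply: eq_bigr => p _; rewrite card_multi_index.
Qed.

Lemma expoE i : (\sum_j expo i j = \sum_j val (tagged i) j)%N.
Proof. by apply: eq_bigr => j _; rewrite ffunE. Qed.

Lemma expo_inj : injective (fun i : I => (tag i, expo i)).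
Proof.
move=> [p b] [p' b'] [] /= pp'; move: b'; rewrite -{}pp' => b' /ffunP eb.
congr existT; apply/val_inj/ffunP => j; apply/val_inj.
by have := eb j; rewrite !ffunE.
Qed.

Lemma order_le p : (r p <= n)%N.
Proof. by rewrite -ltnS (leq_trans _ orders_le)// (bigD1 p)//= leq_addr. Qed.

Lemma expo_le i : (\sum_j expo i j <= r (tag i))%N.
Proof. by rewrite expoE; exact: (valP (tagged i)). Qed.

Let row_of (w : 'rV[R]_d) : 'rV[R]_#|{: I}| := \row_k
  (monom w (expo (enum_val k)) *
   derive1n (\sum_j expo (enum_val k) j)%N sigma (a + (w *m z (tag (enum_val k))) 0 0)).

(** All neurons share the bias [a], where the derivatives of the activation do
    not vanish.  The inner weights are chosen so that the matrix of the
    conditions is invertible, and the outer weights solve the linear system;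
    superfluous neurons get zero weights. *)
Lemma hermite_interpolation (y : forall p, multi_index d (r p) -> 'cV[R]_c) m :
  (\sum_p 'C(d + r p, d) <= m)%N ->
  exists f : 'cV[R]_d -> 'cV[R]_c, [/\ shallow_networks sigma m f,
    forall p (b : multi_index d (r p)), Dmulti b f (z p) = y p b &
    forall p (b : multi_index d (r p)), continuous (Dmulti b f)].
Proof.
move=> Km.
have [l l0|M Mu MS] := @unitmx_rows_in R #|{: I}| (range row_of).
  apply/colP => k; rewrite mxE -[k]enum_valK.
  apply: (@ridge_functional_eq0 _ d n P I z r (@tag _ _) expo z_inj expo_le
    expo_inj orders_le (fun i => l (enum_rank i) 0)) => w q qn.
  apply: (activation_moments sigma_Cn sigma_neq0 _ _ w qn) => [i|{qn}{}w].
    exact: leq_trans (expo_le i) (order_le _).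
  have /(congr1 (fun A : 'M[R]_1 => A 0 0)) := l0 (row_of w) (imageT _ _).
  rewrite !mxE => e0; rewrite -[RHS]e0 (reindex (@enum_val I predT)) /=; last first.
    exact/onW_bij/enum_val_bij.
  by apply: eq_bigr => j _; rewrite enum_valK [row_of w 0 j]mxE mulrC.
have /choice[w wM] k : exists w, row_of w = row k M by case: (MS k) => w _; exists w.
pose Y : 'M[R]_(c, #|{: I}|) := \matrix_(l, k) y _ (tagged (enum_val k)) l 0.
pose W1 := \matrix_k w k; pose W2 := Y *m invmx M.
have nets := ridge_sum_shallow sigma W1 (const_mx a) W2.
have Km' : (#|{: I}| <= m)%N by rewrite card_jets.
eexists; split; first exact: (shallow_networks_widen Km' nets).
  move=> p b; rewrite /Dmulti (partials_ridge_sum sigma_Cn); last first.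
    rewrite size_directions; apply: leq_trans (order_le p); exact: (valP b).
  pose i : I := Tagged (fun p => multi_index d (r p)) b.
  apply/colP => l; rewrite summxE.
  transitivity ((W2 *m M) l (enum_rank i)).
    rewrite mxE; apply: eq_bigr => k _.
    have -> : M k (enum_rank i) = row_of (w k) 0 (enum_rank i) by rewrite wM mxE.
    rewrite [row_of _ _ _]mxE enum_rankK expoE -size_directions [LHS]mxE.
    rewrite [col k W2 l 0]mxE mulrC; congr (_ * (_ * _)).
      have W1w j : W1 k j = w k 0 j by rewrite mxE.
      under eq_bigr do rewrite W1w.
      by rewrite prod_directions; apply: eq_bigr => j _; rewrite ffunE.
    congr (derive1n _ _ _); rewrite mxE addrC [const_mx a k 0]mxE; congr (_ + _).
    by rewrite !mxE; apply: eq_bigr => j _; rewrite [W1 k j]mxE.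
  by rewrite mulmxKV// mxE enum_rankK.
move=> p b; apply: (continuous_partials_ridge_sum sigma_Cn).
by rewrite size_directions; apply: leq_trans (order_le p); exact: (valP b).
Qed.

End interpolation.

(** * Counting the collocation conditions *)

(** The right-hand side is a Vandermonde sum, of which the left-hand side keeps
    the two extreme terms; these are distinct as d > 0. *)
Lemma leq_bin_add (d a b : nat) : (0 < d)%N ->
  ('C(a, d) + 'C(b, d) <= 'C(a + b, d))%N.
Proof.
case: d => // d _; rewrite -binomial.Vandermonde big_ord_recl big_ord_recr/=.
by rewrite /bump/= !bin0 subn0 mul1n add1n subnn bin0 muln1 addnC leq_add2l leq_addl.
Qed.

Lemma leq_sum_bin (I : finType) (d : nat) (a : I -> nat) : (0 < d)%N ->
  (\sum_i 'C(a i, d) <= 'C(\sum_i a i, d))%N.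
Proof.
move=> d0; apply: (big_ind2 (fun x y => (x <= 'C(y, d))%N)) => //.
by move=> x1 x2 y1 y2 h1 h2; rewrite (leq_trans _ (leq_bin_add _ _ d0))// leq_add.
Qed.

Lemma multi_index0_subproof d r : (\sum_i ([ffun=> ord0] : {ffun 'I_d -> 'I_r.+1}) i <= r)%N.
Proof. by rewrite big1// => i _; rewrite ffunE. Qed.

Definition multi_index0 d r : multi_index d r :=
  exist (fun b : {ffun 'I_d -> 'I_r.+1} => is_true (\sum_i b i <= r)%N)
    [ffun=> ord0] (multi_index0_subproof d r).

Lemma Dmulti0 (R : realType) d c r (f : 'cV[R]_d -> 'cV[R]_c) :
  Dmulti (multi_index0 d r) f = f.
Proof.
rewrite /Dmulti (_ : flatten _ = [::])//; apply/nilP.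
rewrite /nilp size_flatten /shape -map_comp sumnE big_map big1// => i _.
by rewrite /= ffunE.
Qed.

(** The interior and the boundary nodes form one family over the disjoint union
    of [A] and [B].  Taking finite sets removes repetitions among the given
    nodes, so [NF] and [NB] only bound the cardinals. *)
Section collocation.
Variables (R : realType) (d c rF rB : nat) (Omega Gamma : set 'cV[R]_d).
Hypothesis d_gt0 : (0 < d)%N.
Hypothesis c_gt0 : (0 < c)%N.
Hypothesis Omega_open : open Omega.
Hypothesis Gamma_sub : Gamma `<=` boundary Omega.
Variables (A B : {fset 'cV[R]_d}).
Hypothesis A_sub : forall z, z \in A -> Omega z.
Hypothesis B_sub : forall z, z \in B -> Gamma z.
Variables (sigma : R -> R) (a : R) (NF NB : nat).
Let ell := (NF * (d + rF) + NB * (d + rB))%N.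
Hypothesis NF_gt0 : (0 < NF)%N.
Hypothesis NB_gt0 : (0 < NB)%N.
Hypothesis A_le : (#|` A| <= NF)%N.
Hypothesis B_le : (#|` B| <= NB)%N.
Hypothesis sigma_Cn : Ck_real (ell - d) sigma.
Hypothesis sigma_neq0 : forall k, (k <= ell - d)%N -> derive1n k sigma a != 0.

Let P := (A + B)%type.
Let node (p : P) : 'cV[R]_d := match p with inl x => val x | inr x => val x end.
Let jet_order (p : P) : nat := match p with inl _ => rF | inr _ => rB end.

(** An interior node is never a boundary node, as [Omega] is open. *)
Lemma node_inj : injective node.
Proof.
have disj (x : A) (y : B) : val x <> val y.
  move=> xy; have [_] := Gamma_sub (B_sub (valP y)).
  apply; rewrite (interior_id _).1// -xy; exact: A_sub (valP x).
move=> [x|x] [y|y] /= xy; [|by have := disj _ _ xy|by have := disj _ _ (esym xy)|];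
  by rewrite (val_inj xy).
Qed.

Lemma sum_node (g : nat -> nat) :
  (\sum_p g (jet_order p) <= NF * g rF + NB * g rB)%N.
Proof.
rewrite big_sumType/= !sum_nat_const -!cardfE.
by rewrite leq_add// leq_mul2r ?A_le ?B_le orbT.
Qed.

Lemma sum_orders_le : (\sum_p (jet_order p).+1 <= (ell - d).+1)%N.
Proof.
apply: leq_trans (sum_node succn) _; rewrite /ell.
case: d d_gt0 NF_gt0 NB_gt0 => // d' _; clear; case: NF NB => // n1 [//|n2] _ _; nia.
Qed.

Lemma sum_bin_le : (\sum_p 'C(d + jet_order p, d) <= c * 'C(ell, d))%N.
Proof.
apply: leq_trans (leq_sum_bin _ d_gt0) _.
apply: leq_trans (leq_bin2l _ (sum_node (addn d))) _.
exact: leq_pmull.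
Qed.

(** The boundary jet of u at z is a limit taken inside [Omega]; whatever its
    value is, a network can interpolate it, because for a network the boundary
    jet is the jet.  Continuity of u up to the boundary is what turns the
    boundary jet of order zero into the value of u. *)
Lemma network_matching_jets (u : 'cV[R]_d -> 'cV[R]_c) :
  {within closure Omega, continuous u} ->
  exists f, [/\ shallow_networks sigma (c * 'C(ell, d)) f,
    (forall z, z \in A ->
      interior_jet f z = interior_jet u z :> (multi_index d rF -> _)),
    (forall z, z \in B ->
      boundary_jet Omega f z = boundary_jet Omega u z :> (multi_index d rB -> _)) &
    (forall z, z \in (A `|` B)%fset -> f z = u z)].
Proof.
move=> uc.
pose y (p : P) : multi_index d (jet_order p) -> 'cV[R]_c :=
  match p with
  | inl x => interior_jet u (val x)
  | inr x => boundary_jet Omega u (val x)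
  end.
have [f [nf fy fc]] :=
  hermite_interpolation node_inj sum_orders_le sigma_Cn sigma_neq0 y sum_bin_le.
have B_closure z : z \in B -> closure Omega z.
  by move=> zB; case: (Gamma_sub (B_sub zB)).
exists f; split=> // z.
- move=> zA; apply/funext => b; exact: (fy (inl [` zA]%fset) b).
- move=> zB; apply/funext => b; rewrite /boundary_jet boundary_value_continuous.
  + exact: (fy (inr [` zB]%fset) b).
  + exact: B_closure.
  + apply: cvg_trans (fc (inr [` zB]%fset) b z); apply: cvg_app; exact: cvg_within.
rewrite inE => /orP[zA|zB].
- have := fy (inl [` zA]%fset) (multi_index0 _ _); rewrite Dmulti0 => ->.
  by rewrite /y/= /interior_jet Dmulti0.
- have := fy (inr [` zB]%fset) (multi_index0 _ _); rewrite Dmulti0 => ->.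
  rewrite /y/= /boundary_jet Dmulti0 boundary_value_continuous//; first exact: B_closure.
  have /subspace_continuousP/(_ z (B_closure _ zB)) := uc.
  apply: cvg_trans; apply: cvg_app; apply: within_subset; exact: subset_closure.
Qed.

End collocation.

Theorem proposition3p1 (R : realType) (d c cF cB rF rB : nat) (nu : R)
  (hd : (0 < d)%N) (hc : (0 < c)%N) (hcF : (0 < cF)%N) (hcB : (0 < cB)%N)
  (hnu : 1 <= nu)
  (Omega Gamma : set 'cV[R]_d)
  (Omega_open : open Omega) (Omega_connected : connected Omega)
  (Omega_nonempty : Omega !=set0)
  (Omega_bounded : bounded_set Omega)
  (Omega_lipschitz : lipschitz_boundary Omega)
  (Gamma_sub : Gamma `<=` boundary Omega)
  (U V W : completeNormedModType R)
  (evU : U -> 'cV[R]_d -> 'cV[R]_c)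
  (evV : V -> 'cV[R]_d -> 'cV[R]_cF)
  (evW : W -> 'cV[R]_d -> 'cV[R]_cB)
  (U_functions : function_space (closure Omega) evU)
  (V_functions : function_space Omega evV)
  (W_functions : function_space Gamma evW)
  (U_embedded : embedded_in_Lnu
     (outer_trace (@lebesgue_outer R d) Omega) nu evU)
  (V_embedded : embedded_in_Lnu
     (outer_trace (@lebesgue_outer R d) Omega) nu evV)
  (W_embedded : embedded_in_Lnu
     (outer_trace (@hausdorff_outer R d d.-1%:R) Gamma) nu evW)
  (opF : U -> V) (opB : U -> W)
  (opF_local : local_operator Omega (@interior_jet R d c rF) evU evV opF)
  (opB_local : local_operator Gamma (@boundary_jet R d c Omega rB) evU evW opB)
  (U_smooth : forall u : U,
     Ck_open rF Omega (evU u) /\ Ck_closure rB Omega (evU u))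
  (NF NB : nat) (hNF : (0 < NF)%N) (hNB : (0 < NB)%N)
  (zF : 'I_NF -> 'cV[R]_d) (zB : 'I_NB -> 'cV[R]_d)
  (zF_in : forall i, Omega (zF i)) (zB_in : forall j, Gamma (zB j))
  (Dh : {fset 'cV[R]_d})
  (alphaF alphaB alphaD : R)
  (halphaF : 0 <= alphaF) (halphaB : 0 <= alphaB) (halphaD : 0 <= alphaD)
  (wF wB wD : 'cV[R]_d -> R) (ustar : 'cV[R]_d -> 'cV[R]_c)
  (sigma : R -> R) :
  let Omegah := [fset zF i | i : 'I_NF]%fset in
  let Gammah := [fset zB j | j : 'I_NB]%fset in
  let J := fun u : U =>
    alphaF * (\sum_(z <- Omegah) wF z * lnorm nu (evV (opF u) z) `^ nu) +
    alphaB * (\sum_(z <- Gammah) wB z * lnorm nu (evW (opB u) z) `^ nu) +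
    alphaD * (\sum_(z <- Dh) wD z * lnorm nu (evU u z - ustar z) `^ nu) in
  let ell := (NF * (d + rF) + NB * (d + rB))%N in
  let nets := @shallow_networks R d c sigma (c * 'C(ell, d)) in
  let HM := [set u : U | exists2 f, nets f &
                           forall x, closure Omega x -> evU u x = f x] in
  {subset Dh <= (Omegah `|` Gammah)%fset} ->
  Ck_real (ell - d) sigma ->
  (exists a : R, forall k, (k <= ell - d)%N -> derive1n k sigma a != 0) ->
  (forall f, nets f ->
     exists u : U, forall x, closure Omega x -> evU u x = f x) ->
  (forall uhat, argmin setT J uhat ->
     exists utheta, [/\ argmin HM J utheta, J utheta = J uhat &
       forall z, z \in (Omegah `|` Gammah)%fset -> evU utheta z = evU uhat z]) /\
  (forall uhat, argmin HM J uhat -> argmin setT J uhat).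
Proof.
move=> Omegah Gammah J ell nets HM Dh_sub sigma_Cn [a sigma_neq0] nets_sub.
have A_sub z : z \in Omegah -> Omega z by case/imfsetP => i _ ->.
have B_sub z : z \in Gammah -> Gamma z by case/imfsetP => i _ ->.
have A_le : (#|` Omegah| <= NF)%N.
  by rewrite -[leqRHS]card_ord cardE; exact: leq_imfset_card.
have B_le : (#|` Gammah| <= NB)%N.
  by rewrite -[leqRHS]card_ord cardE; exact: leq_imfset_card.
clearbody Omegah Gammah.
(* The companion network of u. *)
have match_net u : exists u', [/\ HM u', J u' = J u &
    forall z, z \in (Omegah `|` Gammah)%fset -> evU u' z = evU u z].
  have uc : {within closure Omega, continuous (evU u)} by case: (U_smooth u) => _ [].
  have [f [nf fA fB fz]] := network_matching_jets hd hc Omega_open Gamma_sub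
    A_sub B_sub hNF hNB A_le B_le sigma_Cn sigma_neq0 uc.
  have [u' u'f] := nets_sub f nf.
  have u'O : {in Omega, evU u' =1 f}.
    by move=> x /set_mem Ox; apply: u'f; exact: subset_closure.
  have u'z z : z \in (Omegah `|` Gammah)%fset -> evU u' z = evU u z.
    move=> zAB; rewrite -fz// u'f//; move: zAB; rewrite inE => /orP[/A_sub|/B_sub].
      exact: subset_closure.
    by move/Gamma_sub => [].
  exists u'; split; [by exists f| |exact: u'z].
  case: opF_local => F FE; case: opB_local => B BE.
  have EF z : z \in Omegah -> evV (opF u') z = evV (opF u) z.
    move=> zS; rewrite !FE; [|exact: A_sub..]; rewrite -fA//.
    congr (F _ _); apply/funext => b.
    by apply: (eq_partials Omega_open _ u'O); apply/mem_set/A_sub.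
  have EB z : z \in Gammah -> evW (opB u') z = evW (opB u) z.
    move=> zS; rewrite !BE; [|exact: B_sub..]; rewrite -fB//.
    congr (B _ _); apply/funext => b.
    by apply: eq_boundary_value; exact: (eq_partials Omega_open).
  have SF : \sum_(z <- Omegah) wF z * lnorm nu (evV (opF u') z) `^ nu =
      \sum_(z <- Omegah) wF z * lnorm nu (evV (opF u) z) `^ nu.
    by apply: eq_big_seq => z zS; rewrite (EF z zS).
  have SB : \sum_(z <- Gammah) wB z * lnorm nu (evW (opB u') z) `^ nu =
      \sum_(z <- Gammah) wB z * lnorm nu (evW (opB u) z) `^ nu.
    by apply: eq_big_seq => z zS; rewrite (EB z zS).
  have SD : \sum_(z <- Dh) wD z * lnorm nu (evU u' z - ustar z) `^ nu =
      \sum_(z <- Dh) wD z * lnorm nu (evU u z - ustar z) `^ nu.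
    by apply: eq_big_seq => z zS; rewrite (u'z z (Dh_sub z zS)).
  exact: (congr2 +%R (congr2 +%R (congr1 ( *%R alphaF) SF)
    (congr1 ( *%R alphaB) SB)) (congr1 ( *%R alphaD) SD)).
(* From here on J matters only through [match_net]. *)
clearbody J.
split=> [uhat [_ umin]|uhat [uHM umin]].
  have [u' [u'HM Ju' u'z]] := match_net uhat.
  by exists u'; split => //; split=> // v _; rewrite Ju'; exact: umin.
split=> // v _; have [v' [v'HM <- _]] := match_net v.
exact: umin.
Qed.
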